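(* Let $R$ be a ring, $A$ a right ideal of $R$ with a serial factorization $A=A_1\cdots A_n$, and $B$ a right ideal of $R$ containing $A$. Then: (1) $B$ has a serial factorization if and only if either $B\supseteq A_i$ for some index $i=1,\dots,n$ or $B$ is a two-sided ideal of $R$. (2) If $B$ has a serial factorization, then the serial factorization of $B$ is $B=(B+A_1)\cdots(B+A_n)$, where the factors $B+A_i$ equal to $R$ are omitted.
   Context: Rings are associative with identity $1\neq 0$, not necessarily commutative. The product $IJ$ of two right ideals is the set of finite sums of products $xy$ with $x\in I$, $y\in J$. A right module is uniserial if its lattice of submodules is linearly ordered by inclusion. A finite family $\{A_1,\dots,A_n\}$ of proper right ideals of $R$ is coindependent if $A_i+\bigcap_{j\neq i}A_j=R$ for every $i$ (an empty intersection being $R$). A serial factorization of a right ideal $A$ of $R$ is a factorization $A=A_1\cdots A_n$ where $A_1,\dots,A_n$ are proper right ideals of $R$ forming a coindependent family, $A_iA_j=A_jA_i$ for all $i,j$, and $R/A_i$ is a uniserial right $R$-module for every $i$. The improper ideal $R$ is regarded as having the empty serial factorization ($n=0$, the empty product being $R$). Serial factorizations, when they exist, are unique up to the order of the factors, which justifies saying ''the'' serial factorization. *)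

(* Defs.v *)
From HB Require Import structures.
From mathcomp Require Import all_boot all_order all_algebra.
From mathcomp Require Import mathcomp_extra boolp classical_sets.

Set Implicit Arguments.
Unset Strict Implicit.
Unset Printing Implicit Defensive.

Import GRing.Theory.

Local Open Scope ring_scope.
Local Open Scope classical_set_scope.
Local Open Scope quotient_scope.

Definition right_ideal (R : nzRingType) (I : set R) : Prop :=
  [/\ I 0, forall x y, I x -> I y -> I (x + y) & forall x a, I x -> I (x * a)].

Record rideal (R : nzRingType) := RIdeal {
  rideal_set :> set R;
  ridealP : right_ideal rideal_set
}.

(* Classical decidable equality, for [\in], [!=] and [perm_eq] on sequences of
   right ideals. *)
HB.instance Definition _ (R : nzRingType) := gen_eqMixin (rideal R).

Section RightIdealTheory.
Variables (R : nzRingType) (I J : rideal R).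

Lemma rideal0 : rideal_set I 0. Proof. by case: (ridealP I). Qed.

Lemma ridealD x y :
  rideal_set I x -> rideal_set I y -> rideal_set I (x + y).
Proof. by case: (ridealP I) => _ + _; apply. Qed.

Lemma ridealMr x a : rideal_set I x -> rideal_set I (x * a).
Proof. by case: (ridealP I) => _ _; apply. Qed.

Lemma ridealN x : rideal_set I x -> rideal_set I (- x).
Proof. by rewrite -mulrN1; apply: ridealMr. Qed.

Lemma ridealB x y :
  rideal_set I x -> rideal_set I y -> rideal_set I (x - y).
Proof. by move=> Ix Iy; apply: ridealD => //; apply: ridealN. Qed.

Lemma rideal_ext : (I : set R) = J -> I = J.
Proof.
move: I J => [A hA] [B hB] /= eqAB; subst B.
by congr RIdeal; apply: Prop_irrelevance.
Qed.

End RightIdealTheory.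

Section RightIdealOperations.
Variable R : nzRingType.

Lemma right_ideal_full : right_ideal [set: R].
Proof. by []. Qed.

Definition ridealT : rideal R := RIdeal right_ideal_full.

Lemma right_ideal_add (I J : rideal R) :
  right_ideal [set x + y | x in I & y in J].
Proof.
split=> [|_ _ [x Ix [y Jy <-]] [z Iz [t Jt <-]]|_ a [x Ix [y Jy <-]]].
- by exists 0; [exact: rideal0|exists 0; [exact: rideal0|rewrite addr0]].
- exists (x + z); first exact: ridealD.
  by exists (y + t); [exact: ridealD|rewrite addrACA].
- exists (x * a); first exact: ridealMr.
  by exists (y * a); [exact: ridealMr|rewrite mulrDl].
Qed.

Definition rideal_add (I J : rideal R) : rideal R :=
  RIdeal (right_ideal_add I J).

Lemma right_ideal_mul (I J : rideal R) :
  right_ideal [set z | exists n (x y : 'I_n -> R),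
    [/\ forall i, rideal_set I (x i), forall i, rideal_set J (y i) & z = \sum_(i < n) x i * y i]].
Proof.
split=> [|_ _ [n [x [y [Ix Jy ->]]]] [m [z [t [Iz Jt ->]]]]
        |_ a [n [x [y [Ix Jy ->]]]]].
- exists 0%N, (fun=> 0), (fun=> 0).
  by split=> [i|i|]; [exact: rideal0|exact: rideal0|rewrite big_ord0].
- exists (n + m)%N, (fun i => match split i with inl j => x j | inr k => z k end),
    (fun i => match split i with inl j => y j | inr k => t k end).
  split=> [i|i|]; [by case: (split i)|by case: (split i)|].
  rewrite big_split_ord /=; congr (_ + _); apply: eq_bigr => i _.
    by rewrite (unsplitK (inl _ i)).
  by rewrite (unsplitK (inr _ i)).
- exists n, x, (fun i => y i * a); split=> // [i|]; first exact: ridealMr.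
  by rewrite mulr_suml; apply: eq_bigr => i _; rewrite mulrA.
Qed.

Definition rideal_mul (I J : rideal R) : rideal R :=
  RIdeal (right_ideal_mul I J).

Lemma right_ideal_bigcap (T : Type) (D : set T) (F : T -> rideal R) :
  right_ideal (\bigcap_(i in D) (F i : set R)).
Proof.
split=> [i _|x y Fx Fy i Di|x a Fx i Di]; first exact: rideal0.
  by apply: ridealD; [exact: Fx|exact: Fy].
by apply: ridealMr; exact: Fx.
Qed.

Definition rideal_bigcap (T : Type) (D : set T) (F : T -> rideal R) : rideal R :=
  RIdeal (right_ideal_bigcap D F).

(* The one-term product is the factor itself, without a multiplication by
   [ridealT], which is not neutral on the left. *)
Definition rideal_prod (s : seq (rideal R)) : rideal R :=
  if s is A :: s' then foldl rideal_mul A s' else ridealT.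

Definition two_sided (I : rideal R) : Prop :=
  forall a x, rideal_set I x -> rideal_set I (a * x).

End RightIdealOperations.

Section QuotientModule.
Variables (R : nzRingType) (I : rideal R).

Definition rideal_pred : {pred R} := fun x => `[< rideal_set I x >].

Lemma rideal_pred_zmod_closed : zmod_closed rideal_pred.
Proof.
split=> [|x y /asboolP Ix /asboolP Iy]; apply/asboolP; first exact: rideal0.
exact: ridealB.
Qed.

HB.instance Definition _ := GRing.isZmodClosed.Build R rideal_pred
  rideal_pred_zmod_closed.

(* R / I as a right R-module, that is, as a left module over R^c. *)
Definition rquot : Type := Quotient.quot rideal_pred.

HB.instance Definition _ := GRing.Zmodule.on rquot.

Definition rquot_pi : R -> rquot := \pi_(Quotient.quot rideal_pred).

Lemma rquot_piP (u : rquot) : exists x, u = rquot_pi x.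
Proof. by exists (repr u); rewrite /rquot_pi reprK. Qed.

Lemma rquot_pi_eq (x y : R) : rquot_pi x = rquot_pi y <-> rideal_set I (x - y).
Proof.
rewrite (rwP eqP) (rwP (asboolP (rideal_set I (x - y)))).
by rewrite -[asbool _]/(x - y \in rideal_pred) Quotient.idealrBE.
Qed.

Lemma rquot_piD (x y : R) : rquot_pi (x + y) = rquot_pi x + rquot_pi y.
Proof. exact: (raddfD (\pi_(Quotient.quot rideal_pred))). Qed.

Definition rquot_scale (a : R^c) (u : rquot) : rquot :=
  rquot_pi (repr u * (a : R)).

Lemma rquot_scale_pi (a : R^c) (x : R) :
  rquot_scale a (rquot_pi x) = rquot_pi (x * (a : R)).
Proof.
apply/rquot_pi_eq; rewrite -mulrBl; apply/ridealMr/rquot_pi_eq.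
by rewrite /rquot_pi reprK.
Qed.

Lemma rquot_scaleA (a b : R^c) (u : rquot) :
  rquot_scale a (rquot_scale b u) = rquot_scale (a * b) u.
Proof.
by have [x ->] := rquot_piP u; rewrite !rquot_scale_pi -mulrA.
Qed.

Lemma rquot_scale1 : left_id (1 : R^c) rquot_scale.
Proof. by move=> u; have [x ->] := rquot_piP u; rewrite rquot_scale_pi mulr1. Qed.

Lemma rquot_scaleDr : right_distributive rquot_scale +%R.
Proof.
move=> a u v; have [x ->] := rquot_piP u; have [y ->] := rquot_piP v.
by rewrite -rquot_piD !rquot_scale_pi mulrDl rquot_piD.
Qed.

Lemma rquot_scaleDl (u : rquot) : {morph rquot_scale^~ u : a b / a + b}.
Proof.
move=> a b; have [x ->] := rquot_piP u.
by rewrite !rquot_scale_pi mulrDr rquot_piD.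
Qed.

HB.instance Definition _ := GRing.Zmodule_isLmodule.Build R^c rquot
  rquot_scaleA rquot_scale1 rquot_scaleDr rquot_scaleDl.

Lemma rquot_pi_scale (a x : R) :
  rquot_pi (x * a) = (a : R^c) *: rquot_pi x.
Proof. by rewrite -rquot_scale_pi. Qed.

End QuotientModule.

Definition submodule (S : pzRingType) (M : lmodType S) (N : set M) : Prop :=
  [/\ N 0, forall u v, N u -> N v -> N (u + v) & forall a u, N u -> N (a *: u)].

Definition uniserial (S : pzRingType) (M : lmodType S) : Prop :=
  forall N P : set M, submodule N -> submodule P -> N `<=` P \/ P `<=` N.

Definition proper_rideal (R : nzRingType) (I : rideal R) : Prop := I <> ridealT R.

Definition coindependent (R : nzRingType) (s : seq (rideal R)) : Prop :=
  forall i : 'I_(size s),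
    rideal_add (tnth (in_tuple s) i)
      (rideal_bigcap [set j | j <> i] (tnth (in_tuple s))) = ridealT R.

Definition serial_factorization (R : nzRingType) (A : rideal R)
    (s : seq (rideal R)) : Prop :=
  [/\ A = rideal_prod s,
      forall I, I \in s -> proper_rideal I,
      coindependent s,
      forall I J, I \in s -> J \in s -> rideal_mul I J = rideal_mul J I &
      forall I, I \in s -> uniserial (rquot I)].

Definition has_serial_factorization (R : nzRingType) (A : rideal R) : Prop :=
  exists s, serial_factorization A s.

(* The family (B + A_1, ..., B + A_n) with its improper members omitted. *)
Definition proper_sums (R : nzRingType) (B : rideal R) (s : seq (rideal R)) :
    seq (rideal R) :=
  [seq C <- [seq rideal_add B C | C <- s] | C != ridealT R].

(* Main.v *)
Require Import Defs.
From mathcomp Require Import all_boot all_order all_algebra.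
From mathcomp Require Import mathcomp_extra boolp classical_sets.

(** Two comaximal right ideals whose products in both orders agree are
two-sided, with product equal to their intersection. Hence in a serial
factorization with at least two factors every factor is two-sided and
[A] is the intersection of the [A_i]; the elements [e_i] with [e_i] in [A_j]
for [j <> i] and [1 - e_i] in [A_i] then give [B] as the intersection of the
[B + A_i] for every right ideal [B] containing [A]. If [R / B] is uniserial, the
pairwise comaximal [B + A_i] form a chain, so at most one of them is proper and
[B] contains some [A_i]. Applied to the factors of two serial factorizations of
the same right ideal, this also yields uniqueness. *)

Import GRing.Theory.
Local Open Scope ring_scope.
Local Open Scope classical_set_scope.

Section RightIdeals.
Set Implicit Arguments.
Unset Strict Implicit.

Variable R : nzRingType.
Implicit Types (A B C D E I J K L : rideal R) (s t : seq (rideal R)).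

(** * Sums and products of right ideals *)

Lemma rideal_eq I J : I `<=` J -> J `<=` I -> I = J.
Proof. by move=> IJ JI; apply/rideal_ext/seteqP. Qed.

Lemma rideal_eqT I : rideal_set I 1 -> I = ridealT R.
Proof.
by move=> I1; apply: rideal_eq => // x _; rewrite -[x]mul1r; apply: ridealMr.
Qed.

Lemma rideal_addl I J : I `<=` rideal_add I J.
Proof. by move=> x Ix; exists x => //; exists 0; [exact: rideal0|rewrite addr0]. Qed.

Lemma rideal_addr I J : J `<=` rideal_add I J.
Proof. by move=> x Jx; exists 0; [exact: rideal0|exists x => //; rewrite add0r]. Qed.

Lemma rideal_add_sub I J K : I `<=` K -> J `<=` K -> rideal_add I J `<=` K.
Proof. by move=> IK JK _ [x /IK Kx [y /JK Ky <-]]; apply: ridealD. Qed.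

Lemma rideal_add_idl I J : J `<=` I -> rideal_add I J = I.
Proof.
by move=> JI; apply: rideal_eq (@rideal_addl _ _); apply: rideal_add_sub.
Qed.

Lemma two_sided_add I J : two_sided I -> two_sided J -> two_sided (rideal_add I J).
Proof.
move=> tI tJ a _ [x Ix [y Jy <-]]; rewrite mulrDr.
by exists (a * x); [exact: tI|exists (a * y) => //; exact: tJ].
Qed.

Lemma rideal_mul_in I J x y :
  rideal_set I x -> rideal_set J y -> rideal_set (rideal_mul I J) (x * y).
Proof.
move=> Ix Jy; exists 1%N, (fun=> x), (fun=> y); split=> //.
by rewrite big_ord_recl big_ord0 addr0.
Qed.

Lemma rideal_mul_sub I J K :
  (forall x y, rideal_set I x -> rideal_set J y -> rideal_set K (x * y)) ->
  rideal_mul I J `<=` K.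
Proof.
move=> IJK _ [n [x [y [Ix Jy ->]]]].
apply: (big_ind (rideal_set K)) => [|u v|i _]; first exact: rideal0.
- exact: ridealD.
- exact: IJK.
Qed.

Lemma rideal_mul_subl I J : rideal_mul I J `<=` I.
Proof. by apply: rideal_mul_sub => x y Ix _; apply: ridealMr. Qed.

Lemma rideal_mulA : associative (@rideal_mul R).
Proof.
move=> I J K; apply: rideal_eq.
- apply: rideal_mul_sub => x _ Ix [n [y [z [Jy Kz ->]]]]; rewrite mulr_sumr.
  apply: (big_ind (rideal_set _)) => [|u v|i _]; first exact: rideal0.
  + exact: ridealD.
  + by rewrite mulrA; do 2?apply: rideal_mul_in.
- apply: rideal_mul_sub => _ z [n [x [y [Ix Jy ->]]]] Kz; rewrite mulr_suml.
  apply: (big_ind (rideal_set _)) => [|u v|i _]; first exact: rideal0.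
  + exact: ridealD.
  + by rewrite -mulrA; do 2?apply: rideal_mul_in.
Qed.

(** Lets the two-factor results apply to one factor and the product of all the others. *)
Lemma rideal_mul_foldl_comm I J s :
  (forall C, C \in J :: s -> rideal_mul I C = rideal_mul C I) ->
  rideal_mul I (foldl (@rideal_mul R) J s)
  = rideal_mul (foldl (@rideal_mul R) J s) I.
Proof.
elim: s J => [|D s IHs] J cI /=; first by apply: cI; rewrite mem_head.
apply: IHs => C; rewrite inE => /predU1P[->|sC]; last first.
  by apply: cI; rewrite !inE sC !orbT.
rewrite rideal_mulA cI ?mem_head // -rideal_mulA cI ?rideal_mulA //.
by rewrite !inE eqxx orbT.
Qed.

(** * Comaximal pairs *)

Definition comaximal I J : Prop :=
  exists2 u, rideal_set I u & rideal_set J (1 - u).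

Lemma comaximal_sym I J : comaximal I J -> comaximal J I.
Proof. by case=> u Iu Ju; exists (1 - u) => //; rewrite opprB addrC subrK. Qed.

Lemma comaximalS I J K L :
  I `<=` K -> J `<=` L -> comaximal I J -> comaximal K L.
Proof. by move=> IK JL [u /IK Ku /JL Lu]; exists u. Qed.

Lemma comaximal_subT I J : comaximal I J -> I `<=` J -> J = ridealT R.
Proof.
by case=> u Iu Ju IJ; apply/rideal_eqT; rewrite -(subrK u 1); apply/ridealD/IJ.
Qed.

Lemma comaximal_addT I J : comaximal I J -> rideal_add I J = ridealT R.
Proof.
case=> u Iu Ju; apply: rideal_eqT; exists u => //; exists (1 - u) => //.
by rewrite addrC subrK.
Qed.

(** In [a * x = u * a * x + (1 - u) * a * x] the first term is in [I], the second in [JI = IJ],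
    hence in [I]. *)
Lemma comaximal_comm_two_sided I J :
  comaximal I J -> rideal_mul I J = rideal_mul J I -> two_sided I.
Proof.
case=> u Iu Ju cIJ a x Ix; have -> : a * x = u * a * x + (1 - u) * a * x.
  by rewrite -mulrDl -mulrDl addrC subrK mul1r.
apply: ridealD; first by do 2?apply: ridealMr.
by apply/(@rideal_mul_subl I J); rewrite cIJ; apply/rideal_mul_in/Ix/ridealMr.
Qed.

(** For [x] in both ideals, [x * (1 - u)] is in [IJ] and [x * u] in [JI = IJ]. *)
Lemma comaximal_comm_mul I J : comaximal I J ->
  rideal_mul I J = rideal_mul J I ->
  forall x, rideal_set (rideal_mul I J) x <-> rideal_set I x /\ rideal_set J x.
Proof.
case=> u Iu Ju cIJ x; split=> [IJx|[Ix Jx]].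
  by split; move: IJx; [|rewrite cIJ]; exact: rideal_mul_subl.
rewrite -[x]mulr1 -(subrK u 1) mulrDr; apply: ridealD; first exact: rideal_mul_in.
by rewrite cIJ; apply: rideal_mul_in.
Qed.

(* Comaximal two-sided ideals need not commute (upper triangular 2x2 matrices), so
   commutation has to be inherited from [I] and [J]: both products are equal to the
   intersection of [B + I] and [B + J]. *)
Lemma two_sided_add_comm B I J : two_sided B -> comaximal I J ->
  rideal_mul I J = rideal_mul J I ->
  rideal_mul (rideal_add B I) (rideal_add B J)
  = rideal_mul (rideal_add B J) (rideal_add B I).
Proof.
have meetE I' J' : two_sided B -> comaximal I' J' ->
    rideal_mul I' J' = rideal_mul J' I' -> forall x,
    rideal_set (rideal_mul (rideal_add B I') (rideal_add B J')) x <->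
    rideal_set (rideal_add B I') x /\ rideal_set (rideal_add B J') x.
  move=> tB mIJ cIJ x.
  have tJ : two_sided J'.
    exact: comaximal_comm_two_sided (comaximal_sym mIJ) (esym cIJ).
  split=> [Kx|[[b Bb [i Ii xE]] [b' Bb' [j Jj xE']]]].
    split; first exact: rideal_mul_subl Kx.
    by apply: rideal_mul_sub Kx => y z _ Jz; exact: two_sided_add.
  case: mIJ => u Iu Ju; set K := rideal_mul _ _.
  have IJK : rideal_mul I' J' `<=` K.
    apply: rideal_mul_sub => y z /rideal_addr Iy /rideal_addr Jz.
    exact: rideal_mul_in.
  (* Split [x = x * (1 - u) + x * u], write the second [x] as [b' + j], and split [b' * u] by
     [1 = u + (1 - u)]. The last two terms lie in [J'I'], where commutation is used. *)
  have -> : x = (b + i) * (1 - u) + u * (b' * u) + (1 - u) * b' * u + j * u.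
    rewrite xE -addrA -addrA (addrA (u * _)) -[(1 - u) * b' * u]mulrA.
    by rewrite -mulrDl [u + _]addrC subrK mul1r -mulrDl xE' -mulrDr subrK mulr1.
  apply: ridealD; first apply: ridealD; first apply: ridealD.
  - apply: rideal_mul_in; last exact: rideal_addr.
    by exists b => //; exists i.
  - apply: rideal_mul_in; first exact: rideal_addr.
    exact/rideal_addl/ridealMr.
  - by apply/IJK; rewrite cIJ; apply/rideal_mul_in/Iu/ridealMr.
  - by apply/IJK; rewrite cIJ; apply/rideal_mul_in.
move=> tB mIJ cIJ; apply: rideal_ext; apply/seteqP; split=> x.
  by move/(meetE _ _ tB mIJ cIJ) => [? ?]; apply/meetE => //; exact: comaximal_sym.
move/(meetE _ _ tB (comaximal_sym mIJ) (esym cIJ)) => [? ?].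
exact/meetE.
Qed.

(** * Uniserial quotients *)

(** The correspondence theorem, through images and preimages under [rquot_pi]; afterwards only right
    ideals are compared. *)
Lemma uniserial_rquotP I : uniserial (rquot I) <->
  forall J K, I `<=` J -> I `<=` K -> J `<=` K \/ K `<=` J.
Proof.
split=> [uI J K IJ IK|chain N P sN sP].
  have sub L : I `<=` L -> submodule (rquot_pi I @` (L : set R)).
    move=> IL; split.
    - by exists 0; [exact: rideal0|rewrite /rquot_pi raddf0].
    - move=> _ _ [x Lx <-] [y Ly <-]; rewrite -rquot_piD.
      by exists (x + y) => //; apply: ridealD.
    - move=> a _ [x Lx <-]; exists (x * (a : R)); first exact: ridealMr.
      exact: rquot_pi_scale.
  have pre L x : I `<=` L -> (rquot_pi I @` (L : set R)) (rquot_pi I x) ->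
      rideal_set L x.
    move=> IL [y Ly] /rquot_pi_eq /IL Lyx.
    by rewrite -[x](subKr y); apply: ridealB.
  have [JK|KJ] := uI _ _ (sub J IJ) (sub K IK); [left=> x Jx|right=> x Kx].
    by apply: pre => //; apply: JK; exists x.
  by apply: pre => //; apply: KJ; exists x.
have rN M : submodule M -> right_ideal [set x | M (rquot_pi I x)].
  case=> M0 MD MZ; split=> /= [|x y Mx My|x a Mx].
  - by rewrite /rquot_pi raddf0.
  - by rewrite rquot_piD; apply: MD.
  - by rewrite rquot_pi_scale; apply: MZ.
have IM M (sM : submodule M) : I `<=` RIdeal (rN M sM).
  move=> x Ix /=; have -> : rquot_pi I x = rquot_pi I 0.
    by apply/rquot_pi_eq; rewrite subr0.
  by case: (rN M sM).
have [NP|PN] := chain _ _ (IM N sN) (IM P sP); [left|right] => u;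
  have [x ->] := rquot_piP u; [exact: NP|exact: PN].
Qed.

Lemma uniserial_rquotS I J : I `<=` J -> uniserial (rquot I) -> uniserial (rquot J).
Proof.
move=> IJ /uniserial_rquotP chain; apply/uniserial_rquotP => K L JK JL.
by apply: chain; apply: subset_trans IJ _.
Qed.

(** * Coindependent families and their products *)

(* For proper right ideals this is coindependence: the members are then distinct,
   so the family can be handled as a set rather than through indices. *)
Definition separated s : Prop :=
  uniq s /\ forall C, C \in s -> exists2 e, rideal_set C (1 - e) &
    forall D, D \in s -> D <> C -> rideal_set D e.

(** Equal members at two indices would contain both [e] and [1 - e], hence [1], against
    properness. *)
Lemma coindependent_separated s :
  (forall C, C \in s -> proper_rideal C) -> coindependent s -> separated s.
Proof.
move=> pr co.
have sep (i : 'I_(size s)) : exists2 e, rideal_set (tnth (in_tuple s) i) (1 - e) &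
    forall j, j <> i -> rideal_set (tnth (in_tuple s) j) e.
  have : rideal_set (ridealT R) 1 by [].
  rewrite -(co i) => -[x Cx [e De xe]]; exists e; last exact: De.
  by rewrite -xe addrK.
split.
  rewrite -[s]/(tval (in_tuple s)) -(map_tnth_enum (in_tuple s)).
  rewrite map_inj_uniq ?enum_uniq // => i j eij.
  apply: contrapT => /eqP; rewrite eq_sym => /eqP nij.
  have [e Ce De] := sep i; have := De j nij; rewrite -eij => Ce'.
  apply: (pr (tnth (in_tuple s) i)); first exact: mem_tnth.
  by apply: rideal_eqT; rewrite -(subrK e 1); apply: ridealD.
move=> C /(@tnthP _ _ (in_tuple s)) [i ->]; have [e Ce De] := sep i.
exists e => // D /(@tnthP _ _ (in_tuple s)) [j ->] nij.
by apply: De => eij; apply: nij; rewrite eij.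
Qed.

Lemma separated_coindependent s : separated s -> coindependent s.
Proof.
move=> [us sep] i; apply: rideal_eqT.
have [e Ce De] := sep _ (mem_tnth i (in_tuple s)).
exists (1 - e) => //; exists e; last by rewrite subrK.
move=> j /= nij; apply: De; first exact: (mem_tnth j (in_tuple s)).
move=> eij; apply: nij; apply/val_inj/eqP.
move: eij; rewrite !(tnth_nth (ridealT R)) /= => /eqP.
by rewrite nth_uniq.
Qed.

Lemma separated_comaximal s C D :
  separated s -> C \in s -> D \in s -> C <> D -> comaximal C D.
Proof.
move=> [_ sep] sC sD nCD; have [e De Ce] := sep _ sD.
by exists e => //; apply: Ce.
Qed.

Lemma separated_sub s t : uniq t -> {subset t <= s} -> separated s -> separated t.
Proof.
move=> ut ts [us sep]; split=> // C /ts sC; have [e Ce De] := sep _ sC.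
by exists e => // D /ts; apply: De.
Qed.

Definition pairwise_comm s : Prop :=
  forall C D, C \in s -> D \in s -> rideal_mul C D = rideal_mul D C.

(** Products nest to the left, so the induction removes the last factor [C]. Its [e] lies in every
    other factor, hence by induction in their product, which is thus comaximal with [C]. *)
Lemma rideal_prod_meet s : separated s -> pairwise_comm s ->
  forall x, rideal_set (rideal_prod s) x <-> (forall C, C \in s -> rideal_set C x).
Proof.
elim/last_ind: s => [|s C IHs] sep com x; first by [].
have ss : {subset s <= rcons s C} by move=> D sD; rewrite mem_rcons inE sD orbT.
have sC : C \in rcons s C by rewrite mem_rcons mem_head.
have us : uniq s by case: sep => + _; rewrite rcons_uniq => /andP[].
have nsC : C \notin s by case: sep => + _; rewrite rcons_uniq => /andP[].
have {}IHs := IHs (separated_sub us ss sep) (fun D E sD sE => com _ _ (ss _ sD) (ss _ sE)).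
have meet_rcons : (forall D, D \in rcons s C -> rideal_set D x) <->
    rideal_set (rideal_prod s) x /\ rideal_set C x.
  rewrite IHs; split=> [sx|[sx Cx] D].
    by split=> [D sD|]; apply: sx => //; apply: ss.
  by rewrite mem_rcons inE => /predU1P[->|/sx].
(* With no earlier factor the product is [C] itself, not a multiplication by [C]. *)
rewrite meet_rcons; case: s => [|D s] in sep com ss sC us nsC IHs meet_rcons *.
  by split=> [|[]].
have -> : rideal_prod (rcons (D :: s) C) = rideal_mul (rideal_prod (D :: s)) C.
  by rewrite /= foldl_rcons.
apply: comaximal_comm_mul.
  have [_ /(_ _ sC)[e Ce De]] := sep; exists e => //.
  apply/IHs => E sE; apply: De; first exact: ss.
  by move=> EC; rewrite -EC sE in nsC.
by apply/esym/rideal_mul_foldl_comm => E /ss sE; apply: com.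
Qed.

(** A second factor forces two-sidedness, being comaximal and commuting with the first; a lone
    factor has no such partner. *)
Lemma separated_comm_cases s : separated s -> pairwise_comm s ->
  [\/ s = [::], exists C, s = [:: C] | forall C, C \in s -> two_sided C].
Proof.
move=> sep com; case: s => [|C [|D s]] in sep com *.
- by constructor 1.
- by constructor 2; exists C.
constructor 3 => E sE.
have [us _] := sep.
have [F sF nEF] : exists2 F, F \in [:: C, D & s] & E <> F.
  have [EC|/eqP nEC] := eqVneq E C; last by exists C => //; rewrite mem_head.
  exists D; first by rewrite !inE eqxx orbT.
  by move: us; rewrite EC /= inE negb_or => /andP[/andP[/eqP]].
apply: comaximal_comm_two_sided (com _ _ sE sF).
exact: (separated_comaximal sep).
Qed.

(** * Right ideals containing a product of separated commuting factors *)

Section ContainingIdeals.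
Variables (A B : rideal R) (s : seq (rideal R)).
Hypotheses (sep : separated s) (com : pairwise_comm s).
Hypothesis AE : A = rideal_prod s.
Hypothesis AB : A `<=` B.

(** Given [e] as constructed below, [x = x * (1 - e) + x * e]: the first term lies in every factor,
    hence in [A], and the second in [B]. *)
Lemma meet_two_sided_add x : (forall C, C \in s -> two_sided C) ->
  (forall C, C \in s -> rideal_set (rideal_add B C) x) -> rideal_set B x.
Proof.
move=> ts Bx.
have AP y : (forall C, C \in s -> rideal_set C y) -> rideal_set B y.
  by move=> sy; apply: AB; rewrite AE; apply/rideal_prod_meet.
have [e Be se] : exists2 e, rideal_set B (x * e) &
    forall C, C \in s -> rideal_set C (1 - e).
  have : {subset s <= s} by [].
  (* Induction on a part [t] of [s]; the whole of [s] is still needed to detect membership in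
     [A]. *)
  elim: {-2}s => [_|C t IHt ss]; first by exists 0; [rewrite mulr0; exact: rideal0|].
  have [D tD|e Be te] := IHt; first by apply: ss; rewrite inE tD orbT.
  have sC : C \in s by apply: ss; rewrite mem_head.
  have [f Cf Df] := sep.2 _ sC.
  have Bf : rideal_set B (x * f).
    (* Here [c * f] lies in [C] because [c] does, and in every other factor because [f] does. *)
    have [b Bb [c Cc <-]] := Bx _ sC; rewrite mulrDl.
    apply: ridealD; first exact: ridealMr.
    apply: AP => D sD; have [->|/eqP nDC] := eqVneq D C; first exact: ridealMr.
    exact/ts/Df.
  (* Chosen so that its complement is [(1 - e) * (1 - f)]: the left factor handles [t], the right
     one handles the two-sided [C]. *)
  exists (e + f - e * f).
    rewrite mulrBr mulrDr mulrA.
    by apply: ridealB; [exact: ridealD|exact: ridealMr].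
  have -> : 1 - (e + f - e * f) = (1 - e) * (1 - f).
    by rewrite mulrBr mulr1 mulrBl mul1r -addrA opprD addrA.
  move=> D; rewrite inE => /predU1P[->|tD]; first exact: ts.
  by apply: ridealMr; exact: te.
rewrite -[x]mulr1 -(subrK e 1) mulrDr; apply: ridealD => //.
by apply: AP => C sC; apply: (ts _ sC); apply: se.
Qed.

Lemma uniserial_contains_factor : proper_rideal B -> uniserial (rquot B) ->
  exists2 C, C \in s & C `<=` B.
Proof.
move=> pB /uniserial_rquotP chain.
have [s0|[C sC]|ts] := separated_comm_cases sep com.
- by case: pB; apply: rideal_eqT; apply: AB; rewrite AE s0.
- by exists C; [rewrite sC mem_head|move: AB; rewrite AE sC].
have [C sC pC] : exists2 C, C \in s & proper_rideal (rideal_add B C).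
  apply: contrapT => all_full; apply: pB; apply/rideal_eqT/meet_two_sided_add => //.
  move=> C sC; suff -> : rideal_add B C = ridealT R by [].
  by apply: contrapT => pC; apply: all_full; exists C.
(* It suffices that [C] lies in each [B + D]. If the chain gave [B + D] inside [B + C] instead,
   comaximality would make [B + C] improper. *)
exists C => // x Cx; apply: meet_two_sided_add => // D sD.
have [->|/eqP nDC] := eqVneq D C; first exact: rideal_addr.
have [] := chain (rideal_add B C) (rideal_add B D).
- exact: rideal_addl.
- exact: rideal_addl.
- by apply; exact: rideal_addr.
move=> DC; case: pC; apply: comaximal_subT DC.
apply: comaximalS (@rideal_addr B D) (@rideal_addr B C) _.
exact: (separated_comaximal sep).
Qed.

Lemma proper_sums_separated : separated (proper_sums B s).
Proof.
(* Improper sums all collapse to [R], so injectivity is claimed only where the sum is proper: equal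
   sums of distinct factors are comaximal, hence improper. *)
have inj : {in [seq C <- s | rideal_add B C != ridealT R] &,
    injective (rideal_add B)}.
  move=> C D; rewrite !mem_filter => /andP[/eqP pC sC] /andP[_ sD] eCD.
  apply: contrapT => nCD; apply: pC.
  apply: (@comaximal_subT (rideal_add B D)); last by rewrite eCD.
  apply: comaximalS (@rideal_addr B D) (@rideal_addr B C) _.
  by apply: (separated_comaximal sep) => // /esym.
split; first by rewrite /proper_sums filter_map map_inj_in_uniq ?filter_uniq ?sep.1.
move=> _ /[!mem_filter] /andP[_ /mapP[C sC ->]].
have [e Ce De] := sep.2 _ sC; exists e; first exact: rideal_addr.
move=> _ /[!mem_filter] /andP[_ /mapP[D sD ->]] nDC.
by apply/rideal_addr/De => // DC; apply: nDC; rewrite DC.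
Qed.

Lemma proper_sums_comm : two_sided B -> pairwise_comm (proper_sums B s).
Proof.
move=> tB _ _ /[!mem_filter] /andP[_ /mapP[C sC ->]] /andP[_ /mapP[D sD ->]].
have [->//|/eqP nCD] := eqVneq C D.
by apply: two_sided_add_comm; [|exact: (separated_comaximal sep)|exact: com].
Qed.

(** Any other factor is comaximal with [C], hence with [B], so its sum is omitted and only
    [B + C = B] survives. *)
Lemma proper_sums_factor C : C \in s -> C `<=` B -> proper_rideal B ->
  proper_sums B s = [:: B].
Proof.
move=> sC CB pB.
have sums_B D : D \in s -> rideal_add B D != ridealT R -> D = C.
  move=> sD /eqP pD; apply: contrapT => nDC; apply: pD; apply: comaximal_addT.
  apply: comaximalS CB (fun x Dx => Dx) _.
  by apply: (separated_comaximal sep) => // /esym.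
have BC := rideal_add_idl CB.
rewrite /proper_sums filter_map (eq_in_filter (_ : {in s, _ =1 pred1 C})).
  by rewrite filter_pred1_uniq ?sep.1 //= BC.
move=> D sD /=; apply/idP/eqP => [/sums_B->//|->]; rewrite BC; exact/eqP.
Qed.

End ContainingIdeals.

(** * Serial factorizations: uniqueness and passage to [B] *)

Lemma serial_factorization_separated A s : serial_factorization A s -> separated s.
Proof. by case=> _ pr co _ _; apply: coindependent_separated. Qed.

Lemma serial_factorization_meet A s : serial_factorization A s ->
  forall x, rideal_set A x <-> (forall C, C \in s -> rideal_set C x).
Proof.
move=> fA; have sep := serial_factorization_separated fA.
by case: fA => -> _ _ com _; apply: rideal_prod_meet.
Qed.

Lemma serial_factorization1 B : proper_rideal B -> uniserial (rquot B) ->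
  serial_factorization B [:: B].
Proof.
have memB C : C \in [:: B] -> C = B by rewrite mem_seq1 => /eqP.
move=> pB uB; split=> // [C /memB->//||C D /memB-> /memB->//|C /memB->//].
apply: separated_coindependent; split=> // C /memB->.
exists 1; first by rewrite subrr; exact: rideal0.
by move=> D /memB->.
Qed.

Lemma serial_factorization_full : serial_factorization (ridealT R) [::].
Proof. by split=> //; case. Qed.

Lemma proper_sums_full s : proper_sums (ridealT R) s = [::].
Proof.
apply/nilP; rewrite /nilp size_filter -leqn0 leqNgt -has_count.
apply/hasPn => _ /mapP[C sC ->]; rewrite negbK; apply/eqP/rideal_eqT.
exact: (@rideal_addl (ridealT R) C).
Qed.

(** A factor [C] of [s] contains some [D] of [t], which contains some [E] of [s]. Distinct factors
    of [s] are comaximal and proper, so [E = C], and [D] is squeezed between them. *)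
Lemma serial_factorization_sub_mem A s t : serial_factorization A s ->
  serial_factorization A t -> {subset s <= t}.
Proof.
have sub s' t' C : serial_factorization A s' -> serial_factorization A t' ->
    C \in s' -> exists2 D, D \in t' & D `<=` C.
  move=> fs ft sC; have [_ pr _ _ uni] := fs; have [At _ _ com _] := ft.
  apply: (uniserial_contains_factor (serial_factorization_separated ft) com At).
  - by move=> x /(serial_factorization_meet fs)/(_ _ sC).
  - exact: pr.
  - exact: uni.
move=> fs ft C sC.
have [D tD DC] := sub _ _ _ fs ft sC; have [E sE ED] := sub _ _ _ ft fs tD.
suff EC : E = C by rewrite -(@rideal_eq D C) // -EC.
apply: contrapT => nEC; have [_ pr _ _ _] := fs; apply: (pr _ sC).
apply: (@comaximal_subT E); last exact: subset_trans ED DC.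
exact: separated_comaximal (serial_factorization_separated fs) _ _ nEC.
Qed.

Lemma serial_factorization_unique A s t : serial_factorization A s ->
  serial_factorization A t -> perm_eq s t.
Proof.
move=> fs ft; apply: uniq_perm.
- by case: (serial_factorization_separated fs).
- by case: (serial_factorization_separated ft).
move=> C; apply/idP/idP.
- exact: (serial_factorization_sub_mem fs ft).
- exact: (serial_factorization_sub_mem ft fs).
Qed.

Lemma serial_factorization_two_sided A s : serial_factorization A s ->
  (forall C, C \in s -> two_sided C) -> two_sided A.
Proof.
move=> fA ts a x /(serial_factorization_meet fA) sx.
by apply/(serial_factorization_meet fA) => C sC; apply/ts/sx.
Qed.

(** By the length of the factorization of [B]: if empty, [B] is [R]; if a single factor, [R / B] is
    uniserial; otherwise [B] is an intersection of two-sided ideals. *)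
Lemma serial_factorization_contains A s B : serial_factorization A s ->
  A `<=` B -> has_serial_factorization B ->
  (exists2 C, C \in s & C `<=` B) \/ two_sided B.
Proof.
move=> fA AB [t fB]; have [AE _ _ com _] := fA; have [BE pt _ comt ut] := fB.
have [t0|[C tC]|ts] :=
  separated_comm_cases (serial_factorization_separated fB) comt.
- by right; rewrite BE t0.
- have BC : B = C by rewrite BE tC.
  have tB : B \in t by rewrite tC BC mem_head.
  left; apply: (uniserial_contains_factor _ com AE AB).
  + exact: serial_factorization_separated fA.
  + exact: pt.
  + exact: ut.
- by right; apply: serial_factorization_two_sided fB ts.
Qed.

Lemma serial_factorization_proper_sums A s B : serial_factorization A s ->
  A `<=` B -> (exists2 C, C \in s & C `<=` B) \/ two_sided B ->
  serial_factorization B (proper_sums B s).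
Proof.
move=> fA AB hB; have sep := serial_factorization_separated fA.
have [AE _ _ com uni] := fA.
have [->|pB] := pselect (B = ridealT R).
  by rewrite proper_sums_full; exact: serial_factorization_full.
have factor C : C \in s -> C `<=` B -> serial_factorization B (proper_sums B s).
  move=> sC CB; rewrite (proper_sums_factor sep sC CB pB).
  apply: serial_factorization1 => //.
  exact: uniserial_rquotS CB (uni _ sC).
case: hB => [[C sC CB]|tB]; first exact: factor CB.
(* A single factor equals [A], so it lies in [B] and the previous case applies. *)
have [s0|[C sC]|ts] := separated_comm_cases sep com.
- by case: pB; apply: rideal_eqT; apply: AB; rewrite AE s0.
- by apply: (factor C); [rewrite sC mem_head|move: AB; rewrite AE sC].
have sepB := proper_sums_separated B sep.
have comB := proper_sums_comm sep com tB.
split=> //.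
- apply: rideal_ext; apply/seteqP; split=> x; last first.
    move/(rideal_prod_meet sepB comB) => sx.
    apply: (meet_two_sided_add sep com AE AB ts) => C sC.
    (* An omitted sum is [R] and imposes no condition on [x]. *)
    have [->//|pC] := eqVneq (rideal_add B C) (ridealT R).
    by apply: sx; rewrite mem_filter pC map_f.
  move=> Bx; apply/(rideal_prod_meet sepB comB).
  by move=> _ /[!mem_filter] /andP[_ /mapP[C sC ->]]; apply: rideal_addl.
- by move=> I /[!mem_filter] /andP[/eqP].
- exact: separated_coindependent.
- move=> _ /[!mem_filter] /andP[_ /mapP[C sC ->]].
  exact: uniserial_rquotS (@rideal_addr B C) (uni _ sC).
Qed.

End RightIdeals.

Theorem theorem3p1 (R : nzRingType) (A : rideal R) (As : seq (rideal R))
    (B : rideal R) (hA : serial_factorization A As) (hAB : A `<=` B) :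
  (has_serial_factorization B <->
     (exists2 C : rideal R, C \in As & C `<=` B) \/ two_sided B) /\
  (has_serial_factorization B ->
     serial_factorization B (proper_sums B As) /\
     (forall s : seq (rideal R),
        serial_factorization B s -> perm_eq s (proper_sums B As))).
Proof.
have contains := serial_factorization_contains hA hAB.
have sums := serial_factorization_proper_sums hA hAB.
split; first by split=> // /sums; exists (proper_sums B As).
move=> /contains /sums fB; split=> // s fs.
exact: serial_factorization_unique fs fB.
Qed.
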